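(* Let $d \ge 1$. Let $g : \mathbb{R}^d \to \mathbb{R}^d$ be continuous and linearly homogeneous. Let $f : \mathbb{R}^d \to \mathbb{R}^d$ be continuous with $f(\mathbf{x}) - g(\mathbf{x}) = o(\mathbf{x})$. Then there exists $r > 0$ such that $g^n(\mathbf{x}) \to \mathbf{0}$ as $n \to \infty$ for all $\mathbf{x} \in B_r$ if and only if $\mathbf{0}$ is an exponentially stable fixed point of $f$.
   Context: $\mathbf{0}$ is the origin of $\mathbb{R}^d$, $\|\cdot\|$ is the Euclidean norm, $B_r = \{\mathbf{x} \in \mathbb{R}^d : \|\mathbf{x}\| < r\}$, and $g^n$ denotes the $n$-fold composition of $g$ with itself. A map $g : \mathbb{R}^d \to \mathbb{R}^d$ is linearly homogeneous if $g(\alpha \mathbf{x}) = \alpha g(\mathbf{x})$ for all $\mathbf{x} \in \mathbb{R}^d$ and all real $\alpha \ge 0$. (In particular $g(\mathbf{0}) = \mathbf{0}$.) The notation $h(\mathbf{x}) = o(\mathbf{x})$ means $\|h(\mathbf{x})\|/\|\mathbf{x}\| \to 0$ as $\mathbf{x} \to \mathbf{0}$. Let $F : \mathbb{R}^d \to \mathbb{R}^d$ be continuous with $F(\mathbf{0}) = \mathbf{0}$. The fixed point $\mathbf{0}$ is Lyapunov stable if for all $\varepsilon > 0$ there exists $\delta > 0$ such that $F^n(\mathbf{x}) \in B_\varepsilon$ for all $\mathbf{x} \in B_\delta$ and all $n \ge 0$. It is exponentially stable if it is Lyapunov stable and there exist $\delta > 0$, $a > 0$ and $0 < b < 1$ such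 that $\|F^n(\mathbf{x})\| \le a b^n \|\mathbf{x}\|$ for all $\mathbf{x} \in B_\delta$ and all $n \ge 0$. *)

(* Defs.v *)
From HB Require Import structures.
From mathcomp Require Import all_boot all_order all_algebra.
From mathcomp Require Import all_classical all_reals all_analysis.
Import Order.TTheory GRing.Theory Num.Theory numFieldNormedType.Exports.

Set Implicit Arguments.
Unset Strict Implicit.
Unset Printing Implicit Defensive.

Local Open Scope classical_set_scope.
Local Open Scope ring_scope.

(* The library norm on 'rV[R]_d is the max norm, hence an explicit Euclidean
   norm.  Continuity and convergence in 'rV[R]_d use the library's topology,
   which is the Euclidean one since the two norms are equivalent. *)
Definition enorm (R : realType) (d : nat) (x : 'rV[R]_d) : R :=
  Num.sqrt (\sum_(i < d) x ord0 i ^+ 2).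

Definition eball (R : realType) (d : nat) (r : R) : set 'rV[R]_d :=
  [set x | enorm x < r].

Definition linearly_homogeneous (R : realType) (d : nat)
    (g : 'rV[R]_d -> 'rV[R]_d) : Prop :=
  forall (x : 'rV[R]_d) (alpha : R), 0 <= alpha ->
    g (alpha *: x) = alpha *: g x.

Definition little_o_at0 (R : realType) (d : nat)
    (h : 'rV[R]_d -> 'rV[R]_d) : Prop :=
  enorm (h x) / enorm x @[x --> (0 : 'rV[R]_d)^'] --> (0 : R).

Definition fixed_point0 (R : realType) (d : nat)
    (F : 'rV[R]_d -> 'rV[R]_d) : Prop := F 0 = 0.

Definition lyapunov_stable0 (R : realType) (d : nat)
    (F : 'rV[R]_d -> 'rV[R]_d) : Prop :=
  forall eps : R, 0 < eps ->
    exists2 delta : R, 0 < delta &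
      forall (x : 'rV[R]_d) (n : nat),
        eball delta x -> eball eps (iter n F x).

Definition exponentially_stable0 (R : realType) (d : nat)
    (F : 'rV[R]_d -> 'rV[R]_d) : Prop :=
  lyapunov_stable0 F /\
  exists delta a b : R,
    [/\ 0 < delta, 0 < a, 0 < b < 1 &
      forall (x : 'rV[R]_d) (n : nat),
        eball delta x -> enorm (iter n F x) <= a * b ^+ n * enorm x].

(* Main.v *)
Require Import Defs.
From HB Require Import structures.
From mathcomp Require Import all_boot all_order all_algebra.
From mathcomp Require Import all_classical all_reals all_analysis.
From mathcomp Require Import ring lra.
Import Order.TTheory GRing.Theory Num.Theory numFieldNormedType.Exports.

Set Implicit Arguments.
Unset Strict Implicit.
Unset Printing Implicit Defensive.

Local Open Scope classical_set_scope.
Local Open Scope ring_scope.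

(** Blow [f] up around the origin: [f_t x = t^-1 f (t x)] for [t > 0].  Since
[g] is homogeneous and [f - g = o], the maps [f_t] tend to [g], not only
pointwise but jointly in [(t, x)] as [t -> 0+] and [x -> x0]; limits of this
joint kind compose, and the iterates of [f_t] are the blow-ups of the iterates
of [f], so each iterate of [f] is blown up to the same iterate of [g]
([iter_rescale_cvg]).  Both implications are read off from this.

If every [g]-orbit tends to [0], each point [x] of the unit sphere has an
iterate of [g] of norm below [1/2], and then so has the same iterate of [f_t]
at all points near [x], for small [t].  The sphere being compact, finitely many
such iterates suffice: there are [N] and [delta] such that the [f]-orbit of any
[x] in the [delta]-ball halves its norm within [N] steps, and until then has
norm at most [N |x|] ([finite_time_contraction]).  Restarting from the halved
point gives geometric decay ([geometric_decay]), hence exponential stability;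
the bound [a b^n |x|] also yields Lyapunov stability.

Conversely, a bound [|f^n x| <= a b^n |x|] near [0] is invariant under
blow-up, so it passes to the limit [g], where it holds everywhere
([geometric_bound_transfer]).

The argument is carried out for the norm that induces the topology of the row
vectors, and the Euclidean norm is compared to it at both ends: the equivalence
constant is absorbed in [a] and [delta]. *)

(** * Geometric decay from contraction in bounded time *)

Lemma bernoulli_ge (R : realDomainType) (c : R) n :
  0 <= c <= 1 -> 1 - n%:R * c <= (1 - c) ^+ n.
Proof.
move=> /andP[c0 c1]; elim: n => [|n IHn]; first by rewrite mul0r subr0 expr0.
rewrite exprS; apply: le_trans (ler_wpM2l _ IHn); last by rewrite subr_ge0.
rewrite -natr1; have : 0 <= n%:R * c * c by rewrite !mulr_ge0.
by nra.
Qed.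

(** Split [n] into blocks of length at most [N], each of which halves the norm;
the time left over in the last block costs at most a factor [M].  The rate [b]
only has to satisfy [b ^ N >= 1/2], so that the factor [1/2] of a block
is at most [b] to the power of its length. *)
Lemma geometric_decay (R : realFieldType) (V : normedZmodType R) (f : V -> V)
    (delta M : R) (N : nat) :
  (forall x, `|x| < delta -> exists n, [/\ (0 < n <= N)%N,
     `|iter n f x| <= 2^-1 * `|x| &
     forall k, (k < n)%N -> `|iter k f x| <= M * `|x|]) ->
  exists a b : R, [/\ 0 < a, 0 < b < 1 &
    forall x n, `|x| < delta -> `|iter n f x| <= a * b ^+ n * `|x|].
Proof.
move=> step.
(* By Bernoulli, this rate satisfies b ^ N >= 1 - N c >= 1/2. *)
pose c : R := (2 * N.+1%:R)^-1.
have c01 : 0 < c by rewrite invr_gt0 mulr_gt0.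
have c11 : c <= 2^-1.
  by rewrite lef_pV2 ?posrE ?mulr_gt0// ler_peMr// ler1n.
pose b := 1 - c.
have b0 : 0 < b by rewrite /b; lra.
have b1 : b < 1 by rewrite /b; lra.
have bN n : (n <= N)%N -> 2^-1 <= b ^+ n.
  move=> nN; apply: le_trans (bernoulli_ge n _); last by apply/andP; split; lra.
  suff : n%:R * c <= 2^-1 by lra.
  rewrite /c invfM mulrCA ler_piMr// ler_pdivrMr// mul1r ler_nat.
  exact: leqW.
have M0 : 0 <= `|M| by [].
(* An incomplete block costs M, against a factor b ^ n >= 1/2. *)
pose a : R := 2 * (`|M| + 1).
have a0 : 0 < a by rewrite /a; lra.
exists a, b; split=> //; first by rewrite b0.
move=> x n; elim/ltn_ind: n x => n IHn x xd.
have [k [/andP[k0 kN] fk fj]] := step x xd.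
have [nk|kn] := ltnP n k.
  apply: le_trans (fj n nk) _; apply: ler_wpM2r => //.
  have bn : 2^-1 <= b ^+ n by apply: bN; rewrite (leq_trans (ltnW nk)).
  apply: (le_trans (ler_norm M)).
  have : a * 2^-1 <= a * b ^+ n by rewrite ler_pM2l.
  by rewrite /a; lra.
have fkd : `|iter k f x| < delta.
  by apply: le_lt_trans xd; apply: le_trans fk _; rewrite ler_piMl//; lra.
rewrite -{1}(subnK kn) iterD.
apply: le_trans (IHn _ _ _ fkd) _; first by rewrite ltn_subrL k0 (leq_trans k0).
rewrite -[in leRHS](subnK kn) exprD !mulrA -[leRHS]mulrA.
apply: ler_wpM2l; first by rewrite mulr_ge0 ?exprn_ge0// ltW.
by apply: le_trans fk _; rewrite ler_wpM2r ?bN.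
Qed.

(** * Blow-up at the origin *)

Definition rescale (R : fieldType) (V : lmodType R) (f : V -> V)
  (t : R) (x : V) : V := t^-1 *: f (t *: x).

(** Blowing up is conjugation by a dilation, hence commutes with iteration. *)
Lemma iter_rescale (R : fieldType) (V : lmodType R) (f : V -> V) n t x :
  t != 0 -> iter n (rescale f t) x = rescale (iter n f) t x.
Proof.
move=> t0; elim: n => [|n IHn] /=; first by rewrite /rescale scalerK.
by rewrite IHn /rescale scalerA divff// scale1r.
Qed.

Section rescaling.
Context (R : realFieldType) (V : normedModType R).
Variables f g : V -> V.
Hypothesis ghom : forall x (a : R), 0 <= a -> g (a *: x) = a *: g x.

Lemma iter_hom n x (a : R) : 0 <= a -> iter n g (a *: x) = a *: iter n g x.
Proof. by move=> a0; elim: n => //= n ->; rewrite ghom. Qed.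

Hypothesis gcont : continuous g.
Hypothesis fg : forall e : R, 0 < e ->
  \forall x \near 0, `|f x - g x| <= e * `|x|.

(** By homogeneity, [rescale f t y - g y] is [t^-1] times [f - g] at [t y],
of norm at most [e |y|] for small [t y]; [y] stays bounded as it tends to [x]. *)
Lemma rescale_cvg x :
  rescale f p.1 p.2 @[p --> (0^'+, nbhs x)] --> g x.
Proof.
suff fg0 : rescale f p.1 p.2 - g p.2 @[p --> (0^'+, nbhs x)] --> 0.
  rewrite -[g x]add0r.
  have -> : (fun p => rescale f p.1 p.2) =
      (fun p : R * V => (rescale f p.1 p.2 - g p.2) + g p.2).
    by apply/funext => p; rewrite subrK.
  apply: cvgD => //; apply: (@cvg_comp _ _ _ snd g _ (nbhs x)); last exact: gcont.
  exact: cvg_snd.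
have sc0 : p.1 *: p.2 @[p --> (0^'+, nbhs x)] --> (0 : V).
  rewrite -(scale0r x); apply: cvgZ; last exact: cvg_snd.
  have : p.1 @[p --> (0^'+, nbhs x)] --> (0 : R)^'+ by exact: cvg_fst.
  by move/cvg_trans; apply; exact: cvg_within.
apply/cvgr0Pnorm_le => e e0.
have e'0 : 0 < e / (`|x| + 1) by rewrite divr_gt0// ltr_wpDl.
near=> p.
have p0 : 0 < p.1.
  near: p; apply: (@cvg_fst _ _ 0^'+ (nbhs x) _ [set t | 0 < t]).
  exact: nbhs_right_gt.
have px : `|p.2| <= `|x| + 1.
  near: p; apply: (@cvg_snd _ _ 0^'+ (nbhs x) _ [set y | `|y| <= `|x| + 1]).
  apply: (@cvgr_norm_le _ _ _ (nbhs x) _ id x) => //.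
  by rewrite ltrDl.
have : `|f (p.1 *: p.2) - g (p.1 *: p.2)| <= e / (`|x| + 1) * `|p.1 *: p.2|.
  near: p; exact: sc0 (fg e'0).
rewrite (ghom _ (ltW p0)) normrZ gtr0_norm// => fgp.
have -> : rescale f p.1 p.2 - g p.2 =
    p.1^-1 *: (f (p.1 *: p.2) - p.1 *: g p.2).
  by rewrite scalerBr scalerK ?gt_eqF.
rewrite normrZ gtr0_norm ?invr_gt0// mulrC ler_pdivrMr//.
apply: (le_trans fgp); rewrite (mulrC p.1) mulrA ler_pM2r//.
by rewrite mulrAC ler_pdivrMr ?ltr_wpDl// ler_pM2l.
Unshelve. all: by end_near.
Qed.

(** Convergence with the base point moving is what makes the induction work:
the step evaluates [rescale f t] at the moving point
[iter n (rescale f t) y]. *)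
Lemma iter_rescale_cvg n x :
  rescale (iter n f) p.1 p.2 @[p --> (0^'+, nbhs x)] --> iter n g x.
Proof.
suff : iter n (rescale f p.1) p.2 @[p --> (0^'+, nbhs x)] --> iter n g x.
  apply: cvg_trans; apply: near_eq_cvg; near=> p.
  rewrite iter_rescale// gt_eqF//.
  near: p; apply: (@cvg_fst _ _ 0^'+ (nbhs x) _ [set t | 0 < t]).
  exact: nbhs_right_gt.
have H : p.2 @[p --> ((0:R)^'+, nbhs x)] --> x by exact: cvg_snd.
elim: n => [|n IHn] /=; first exact: H.
apply: (@cvg_comp _ _ _ (fun p : R * V => (p.1, iter n (rescale f p.1) p.2))
  (fun p : R * V => rescale f p.1 p.2) _
  (filter_prod 0^'+ (nbhs (iter n g x)))); last exact: rescale_cvg.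
have fst0 : p.1 @[p --> ((0 : R)^'+, nbhs x)] --> (0 : R)^'+ by exact: cvg_fst.
exact: cvg_pair fst0 IHn.
Unshelve. all: by end_near.
Qed.

End rescaling.

(** * Stability passes between a map and its homogeneous part *)

Section stability_transfer.
Context (R : realType) (V : normedModType R).
Variables f g : V -> V.
Hypothesis ghom : forall x (a : R), 0 <= a -> g (a *: x) = a *: g x.
Hypothesis gcont : continuous g.
Hypothesis fg : forall e : R, 0 < e ->
  \forall x \near 0, `|f x - g x| <= e * `|x|.

(** The number of steps and the bound along the way depend on the point of the
sphere; using one integer [N] for both turns their uniformity into a statement
for [N] near infinity, which compactness of the sphere gives together with the
uniformity in the scale [t]. *)
Lemma finite_time_contraction :
  compact [set y : V | `|y| = 1] -> f 0 = 0 ->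
  (forall x, iter n g x @[n --> \oo] --> 0) ->
  exists (delta : R) (N : nat), 0 < delta /\
    forall x, `|x| < delta -> exists n, [/\ (0 < n <= N)%N,
      `|iter n f x| <= 2^-1 * `|x| &
      forall k, (k < n)%N -> `|iter k f x| <= N%:R * `|x|].
Proof.
move=> cptS f0 g0.
pose P (p : R * nat) (y : V) := exists n, [/\ (0 < n <= p.2)%N,
  `|rescale (iter n f) p.1 y| <= 2^-1 &
  forall k, (k < n)%N -> `|rescale (iter k f) p.1 y| <= p.2%:R].
have [[A B] /= [nA nB] ABP] :
    \forall p \near filter_prod (0 : R)^'+ \oo, [set y : V | `|y| = 1] `<=` P p.
  apply: (proj1 (compact_near_coveringP _) cptS) => x _.
  pose F := filter_prod (nbhs x) (filter_prod (0 : R)^'+ \oo).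
  have cvgf k : rescale (iter k f) q.2.1 q.1 @[q --> F] --> iter k g x.
    have c1 : q.1 @[q --> F] --> x by exact: cvg_fst.
    have c2 : q.2 @[q --> F] --> filter_prod (0 : R)^'+ \oo by exact: cvg_snd.
    have c21 : q.2.1 @[q --> F] --> (0 : R)^'+.
      by apply: (cvg_trans (cvg_app fst c2)); exact: cvg_fst.
    have := iter_rescale_cvg (n := k) (x := x) ghom gcont fg.
    exact: (@cvg_comp _ _ _ (fun q : V * (R * nat) => (q.2.1, q.1))
      (fun p : R * V => rescale (iter k f) p.1 p.2) _
      (filter_prod 0^'+ (nbhs x)) _ (cvg_pair c21 c1)).
  have F2 (Q : set nat) : (\forall m \near \oo, Q m) -> \forall q \near F, Q q.2.2.
    move=> nQ; apply: (@cvg_snd _ _ (nbhs x) _ _ [set p : R * nat | Q p.2]).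
    exact: (@cvg_snd _ _ (0 : R)^'+ \oo _ Q).
  have [n [n0 gn]] : exists n, (0 < n)%N /\ `|iter n g x| < 2^-1.
    have half0 : 0 < 2^-1 :> R by rewrite invr_gt0.
    have [n [n0 gn]] :=
      filter_ex (filterI (nbhs_infty_gt 0) (cvgr0_norm_lt _ (g0 x) _ half0)).
    by exists n.
  near=> q; exists n; split.
  - by rewrite n0; near: q; apply: (F2 [set m | (n <= m)%N]); exact: nbhs_infty_ge.
  - near: q; exact: (cvgr_norm_le _ (cvgf n) _ gn).
  - suff kb (k : 'I_n) : `|rescale (iter k f) q.2.1 q.1| <= q.2.2%:R.
      by move=> k kn; exact: (kb (Ordinal kn)).
    move: k; near: q; apply: filter_forall => k.
    near=> q; apply: (@le_trans _ _ (`|iter k g x| + 1)).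
      by near: q; apply: (cvgr_norm_le _ (cvgf k)); rewrite ltrDl.
    by near: q; apply: (F2 [set m | _ <= m%:R]); exact: nbhs_infty_ger.
have [N BN] := filter_ex nB.
move: nA => /nbhs_norm0P[delta /= delta0 Adelta].
(* N.+1 rather than N, so that one step is allowed at the point 0. *)
exists delta, N.+1; split=> // x xdelta.
have [->|x0] := eqVneq x 0.
  exists 1%N; split=> //=; first by rewrite f0 normr0 mulr0.
  by case=> //= _; rewrite normr0 mulr0.
have nx0 : 0 < `|x| by rewrite normr_gt0.
have At : A `|x| by apply: Adelta => //=; rewrite normr_id.
(* The scale is |x| and the point of the sphere is the direction of x. *)
have [/=||n [/andP[n0 nN] fn fk]] := ABP (`|x|, N) _ (`|x|^-1 *: x).
- by split.
- by rewrite /= normrZ normfV normr_id mulVf ?gt_eqF.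
have rsE k : `|rescale (iter k f) `|x| (`|x|^-1 *: x)| = `|x|^-1 * `|iter k f x|.
  by rewrite /rescale scalerA divff ?gt_eqF// scale1r normrZ normfV normr_id.
exists n; split.
- by rewrite n0 leqW.
- by rewrite -ler_pdivrMr// mulrC -rsE.
- move=> k kn; rewrite -ler_pdivrMr// mulrC -rsE.
  by apply: le_trans (fk k kn) _; rewrite ler_nat.
Unshelve. all: by end_near.
Qed.

(** The bound is homogeneous in [x], so the blow-ups satisfy it on balls of
radius [delta / t], which exhaust the space as [t -> 0+]. *)
Lemma geometric_bound_transfer (delta a b : R) : 0 < delta ->
  (forall x n, `|x| < delta -> `|iter n f x| <= a * b ^+ n * `|x|) ->
  forall x n, `|iter n g x| <= a * b ^+ n * `|x|.
Proof.
move=> delta0 fb x n.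
have cvgt : rescale (iter n f) t x @[t --> (0 : R)^'+] --> iter n g x.
  have c1 : t @[t --> (0 : R)^'+] --> (0 : R)^'+ by exact: cvg_id.
  have c2 : x @[t --> (0 : R)^'+] --> x by exact: cvg_cst.
  have := iter_rescale_cvg (n := n) (x := x) ghom gcont fg.
  exact: (@cvg_comp _ _ _ (fun t : R => (t, x))
    (fun p : R * V => rescale (iter n f) p.1 p.2) _
    (filter_prod 0^'+ (nbhs x)) _ (cvg_pair c1 c2)).
apply: (cvgr_to_le (cvg_norm cvgt)); near=> t.
have t0 : 0 < t by near: t; exact: nbhs_right_gt.
rewrite normrZ gtr0_norm ?invr_gt0// mulrC ler_pdivrMr//.
apply: le_trans (fb (t *: x) n _) _; rewrite normrZ gtr0_norm//.
  apply: (@le_lt_trans _ _ (t * (`|x| + 1))).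
    by rewrite ler_pM2l// lerDl.
  rewrite -ltr_pdivlMr ?ltr_wpDl//.
  by near: t; apply: nbhs_right_lt; rewrite divr_gt0 ?ltr_wpDl.
by rewrite [t * _]mulrC mulrA.
Unshelve. all: by end_near.
Qed.

End stability_transfer.

(** * Comparison of the Euclidean norm with the sup norm *)

Section euclidean_norm.
Context (R : realType) (d : nat).
Implicit Types x : 'rV[R]_d.

Lemma enorm_ge0 x : 0 <= enorm x. Proof. exact: sqrtr_ge0. Qed.

Lemma coord_le_norm x i : `|x ord0 i| <= `|x|.
Proof.
rewrite [leRHS]mx_normrE.
exact: (le_bigmax _ (fun i : 'I_1 * 'I_d => `|x i.1 i.2|) (ord0, i)).
Qed.

Lemma norm_le_enorm x : `|x| <= enorm x.
Proof.
rewrite [leLHS]mx_normrE; apply/bigmax_leP; split=> [|[i j] _ /=].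
  exact: enorm_ge0.
rewrite (ord1 i) -sqrtr_sqr; apply: ler_wsqrtr.
by rewrite (bigD1 j)//= lerDl sumr_ge0// => k _; exact: sqr_ge0.
Qed.

(** The optimal constant is the square root of [d]; [d.+1] is larger, rational,
and positive for every [d]. *)
Lemma enorm_le_norm x : enorm x <= d.+1%:R * `|x|.
Proof.
have K0 : 0 <= d.+1%:R * `|x| by rewrite mulr_ge0.
rewrite -[leRHS]ger0_norm// -sqrtr_sqr; apply: ler_wsqrtr.
apply: (@le_trans _ _ (\sum_(i < d) `|x| ^+ 2)).
  apply: ler_sum => i _.
  by rewrite -[leLHS]real_normK ?num_real// lerXn2r ?nnegrE ?coord_le_norm.
rewrite sumr_const card_ord -[leLHS]mulr_natl exprMn.
apply: ler_wpM2r; first exact: sqr_ge0.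
by rewrite -natrX ler_nat (leq_trans (leqnSn d))// leq_pmull.
Qed.

End euclidean_norm.

(** * The little-o condition in the sup norm *)

Section little_o.
Context (R : realType) (d : nat) (h : 'rV[R]_d -> 'rV[R]_d).
Hypothesis ho : little_o_at0 h.

Lemma little_o_dnbhs (e : R) : 0 < e ->
  \forall x \near (0 : 'rV[R]_d)^', `|h x| <= e * `|x|.
Proof.
move=> e0; have e'0 : 0 < e / d.+1%:R by rewrite divr_gt0.
near=> x.
have x0 : x != 0 by near: x; exact: nbhs_dnbhs_neq.
have nx0 : 0 < enorm x by apply: lt_le_trans (norm_le_enorm x); rewrite normr_gt0.
have : `|enorm (h x) / enorm x| <= e / d.+1%:R.
  by near: x; exact: (cvgr0_norm_le _ ho).
rewrite ger0_norm ?divr_ge0 ?enorm_ge0// ler_pdivrMr// => hx.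
apply: (le_trans (norm_le_enorm _)); apply: (le_trans hx).
by rewrite -mulrA ler_pM2l// ler_pdivrMl// enorm_le_norm.
Unshelve. all: by end_near.
Qed.

Lemma little_o_nbhs : h 0 = 0 -> forall e : R, 0 < e ->
  \forall x \near (0 : 'rV[R]_d), `|h x| <= e * `|x|.
Proof.
move=> h0 e e0; have := little_o_dnbhs e0; rewrite near_withinE.
apply: filterS => x hx; have [->|/hx//] := eqVneq x 0.
by rewrite h0 normr0 mulr0.
Qed.

(** The little-o condition ignores the value at [0]; continuity recovers it,
because [0] is not isolated when [d] is positive. *)
Lemma little_o_eq0 : (0 < d)%N -> {for 0, continuous h} -> h 0 = 0.
Proof.
move=> d0 hc.
have pf : ProperFilter (0 : 'rV[R]_d)^'.
  apply: Build_ProperFilter_ex => P /nbhs_norm0P[delta /= delta0 deltaP].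
  pose x : 'rV[R]_d := const_mx (delta / 2).
  have x0 : x != 0.
    apply/eqP => /matrixP/(_ ord0 (Ordinal d0)); rewrite !mxE => /eqP.
    by rewrite gt_eqF ?divr_gt0.
  exists x; apply: deltaP => //=; apply: (@le_lt_trans _ _ (delta / 2)); last by lra.
  rewrite [leLHS]mx_normrE; apply/bigmax_leP; split=> [|i _].
    by rewrite divr_ge0// ltW.
  by rewrite mxE ger0_norm// divr_ge0// ltW.
apply/eqP; rewrite -normr_le0; apply/ler_addgt0Pl => e e0; rewrite addr0.
have hc' : h x @[x --> (0 : 'rV[R]_d)^'] --> h 0.
  by apply: cvg_trans hc; apply: cvg_app; exact: cvg_within.
apply: (cvgr_to_le (cvg_norm hc')); near=> x.
have : `|h x| <= 1 * `|x| by near: x; exact: little_o_dnbhs.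
rewrite mul1r => /le_trans; apply.
by near: x; exact: dnbhs0_le.
Unshelve. all: by end_near.
Qed.

End little_o.

(** * Exponential stability and the homogeneous part *)

Theorem theorem3p3 (R : realType) (d : nat) (hd : (1 <= d)%N)
    (g : 'rV[R]_d -> 'rV[R]_d) (hgc : continuous g)
    (hgh : linearly_homogeneous g)
    (f : 'rV[R]_d -> 'rV[R]_d) (hfc : continuous f)
    (hfg : little_o_at0 (fun x => f x - g x)) :
  (exists2 r : R, 0 < r &
     forall x : 'rV[R]_d, eball r x ->
       iter n g x @[n --> \oo] --> (0 : 'rV[R]_d)) <->
  (fixed_point0 f /\ exponentially_stable0 f).
Proof.
have K0 : 0 < d.+1%:R :> R by [].
have g00 : g 0 = 0 by have := hgh 0 0 (lexx 0); rewrite !scale0r.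
have fg0 : f 0 - g 0 = 0.
  apply: (little_o_eq0 hfg hd).
  by apply: continuousB; [exact: hfc|exact: hgc].
have f00 : f 0 = 0 by move: fg0; rewrite g00 subr0.
have fg := little_o_nbhs hfg fg0.
split=> [[r r0 gr]|[_ [_ [delta [a [b [delta0 a0 /andP[b0 b1] fb]]]]]]].
  have g0 x : iter n g x @[n --> \oo] --> (0 : 'rV[R]_d).
    (* Homogeneity brings x into the given ball. *)
    pose s := r / (d.+1%:R * (`|x| + 1)).
    have s0 : 0 < s by rewrite divr_gt0// mulr_gt0// ltr_wpDl.
    have sxr : eball r (s *: x).
      apply: le_lt_trans (enorm_le_norm _) _.
      have -> : r = s * (d.+1%:R * (`|x| + 1)).
        by rewrite divfK// gt_eqF// mulr_gt0// ltr_wpDl.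
      by rewrite normrZ gtr0_norm// mulrCA !ltr_pM2l// ltrDl.
    have -> : (fun n => iter n g x) = (fun n => s^-1 *: iter n g (s *: x)).
      by apply/funext => n; rewrite (iter_hom hgh) ?scalerK ?gt_eqF// ltW.
    by rewrite -(scaler0 _ s^-1); apply: cvgZr; exact: gr.
  have cptS : compact [set y : 'rV[R]_d | `|y| = 1].
    apply: bounded_closed_compact.
      exists 1; split=> // M M1 y /= ->; exact: ltW.
    rewrite (_ : [set _ | _] = (fun y : 'rV[R]_d => `|y|) @^-1` [set 1])//.
    apply: preimage_closed; last exact: closed_eq.
    by move=> y _; exact: norm_continuous.
  have [delta [N [delta0 step]]] := finite_time_contraction hgh hgc fg cptS f00 g0.
  have [a [b [a0 b01 fb]]] := geometric_decay step.
  pose a' := d.+1%:R * a.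
  have a'0 : 0 < a' by rewrite mulr_gt0.
  have fb' x n : eball delta x -> enorm (iter n f x) <= a' * b ^+ n * enorm x.
    rewrite /eball /= => xdelta.
    apply: le_trans (enorm_le_norm _) _; rewrite /a' -!mulrA ler_pM2l// mulrA.
    have [/ltW b0 _] := andP b01.
    apply: le_trans (fb _ n (le_lt_trans (norm_le_enorm x) xdelta)) _.
    by rewrite ler_wpM2l ?norm_le_enorm// mulr_ge0 ?exprn_ge0// ltW.
  split=> //; split; last by exists delta, a', b.
  move=> eps eps0; exists (Num.min delta (eps / a')).
    by rewrite lt_min delta0 divr_gt0.
  move=> x n; rewrite /eball /= lt_min => /andP[xdelta xeps].
  apply: le_lt_trans (fb' x n xdelta) _.
  apply: (@le_lt_trans _ _ (a' * enorm x)); last by rewrite mulrC -ltr_pdivlMr.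
  have [b0 b1] := andP b01.
  by rewrite -mulrA ler_pM2l// ler_piMl ?enorm_ge0// exprn_ile1// ltW.
exists 1 => // x _.
have delta'0 : 0 < delta / d.+1%:R by rewrite divr_gt0.
have fb' y n : `|y| < delta / d.+1%:R ->
    `|iter n f y| <= a * d.+1%:R * b ^+ n * `|y|.
  rewrite ltr_pdivlMr// mulrC => ydelta.
  apply: (le_trans (norm_le_enorm _)).
  apply: (le_trans (fb _ _ (le_lt_trans (enorm_le_norm y) ydelta))).
  rewrite [leRHS](_ : _ = a * b ^+ n * (d.+1%:R * `|y|)); last by ring.
  by rewrite ler_wpM2l ?enorm_le_norm// mulr_ge0 ?exprn_ge0// ltW.
have gb := geometric_bound_transfer hgh hgc fg delta'0 fb'.
apply/norm_cvg0P.
apply: (squeeze_cvgr (f := fun=> 0) (h := fun n => a * d.+1%:R * b ^+ n * `|x|)).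
- by near=> n; rewrite normr_ge0 gb.
- exact: cvg_cst.
- rewrite -(mul0r `|x|) -[in X in _ --> X](mulr0 (a * d.+1%:R)).
  apply: cvgMl; apply: cvgMr; apply: cvg_expr.
  by rewrite ger0_norm// ltW.
Unshelve. all: by end_near.
Qed.
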